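(* Let $p\ge 1/2$ be fixed and let $\epsilon>0$ be an arbitrarily small constant. In the Majority Model (MM) on the cycle $C_n$ started from a $p$-random initial coloring, with probability $1-o(1)$ as $n\to\infty$ the process reaches, within $\mathcal{O}(\log n)$ rounds, a stable coloring whose number of blue nodes is between $(1-\epsilon)\frac{2p^2-p^3}{1-p+p^2}n$ and $(1+\epsilon)\frac{2p^2-p^3}{1-p+p^2}n$.
   Context: A coloring is a map from the nodes to $\{b,w\}$. In MM, all nodes update simultaneously: a node adopts the color strictly more frequent among its neighbors in the previous round and keeps its color in case of a tie. A coloring is stable if one application of the update rule returns it unchanged. A $p$-random coloring colors each node blue independently with probability $p$ and white otherwise. *)

(* Defs.v *)
From HB Require Import structures.
From mathcomp Require Import all_boot all_order all_algebra.
From mathcomp Require Import boolp reals exp.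
Set Implicit Arguments. Unset Strict Implicit. Unset Printing Implicit Defensive.
Import Order.TTheory GRing.Theory Num.Theory.
Local Open Scope ring_scope.

(* A coloring: true = blue (b), false = white (w). *)
Definition coloring (T : finType) := {ffun T -> bool}.

Definition mm_step (T : finType) (adj : rel T) (c : {ffun T -> bool})
  : {ffun T -> bool} :=
  [ffun v =>
     let nb := #|[set u | adj v u && c u]| in
     let nw := #|[set u | adj v u && ~~ c u]| in
     if (nw < nb)%N then true else if (nb < nw)%N then false else c v].

Definition mm_iter (T : finType) (adj : rel T) (t : nat) (c : {ffun T -> bool}) :=
  iter t (mm_step adj) c.

Definition stable (T : finType) (adj : rel T) (c : {ffun T -> bool}) : bool :=
  mm_step adj c == c.

Definition cycle_adj (n : nat) : rel 'I_n :=
  fun i j => (i != j) && ((val j == (val i).+1 %% n)%N || (val i == (val j).+1 %% n)%N).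

Definition nblue (T : finType) (c : {ffun T -> bool}) : nat := #|[set v | c v]|.

Definition prand (R : realType) (n : nat) (p : R) (A : pred {ffun 'I_n -> bool}) : R :=
  \sum_(c | A c) \prod_(i : 'I_n) (if c i then p else 1 - p).

(* Main.v *)
Require Import Defs.
From HB Require Import structures.
From mathcomp Require Import all_boot all_order all_algebra.
From mathcomp Require Import boolp reals exp.
From mathcomp Require Import zify ring lra.
Import Order.TTheory GRing.Theory Num.Theory.
Local Open Scope ring_scope.

(** On the cycle a vertex changes color exactly when it disagrees with both
    neighbours, and such a configuration of radius 1 at time [t] is the trace of
    an alternating block of radius [t + 1] in the initial coloring. So the
    color of [v] at time [t] is its initial color plus the sum over
    [1 <= d <= t] of the indicators that the ball of radius [d] around [v]
    alternates with blue endpoints, minus those with white endpoints. These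
    events have probability [p (p q)^d] and [q (p q)^d] with [q = 1 - p], whence
    the density [p + (2 p - 1) p q / (1 - p q)].

    For [t = trunc_log 2 n], a union bound shows that no alternating block of
    radius [t + 1] exists, i.e. the coloring is stable, with probability at
    least [1 - 1 / n]. The colors at time [t] of vertices with disjoint windows
    of radius [t] are independent, so the variance of the number of blue
    vertices is [O(n log n)] and Chebyshev's inequality applies. *)

(** * Expectation and independence under the product measure on colorings *)

Section ProductMeasure.
Context {R : realType} {I : finType} (p : R).
Implicit Types (c : {ffun I -> bool}) (S : {set I}).

Definition color_weight (b : bool) : R := if b then p else 1 - p.

Definition weight c : R := \prod_i color_weight (c i).

Definition expect (f : {ffun I -> bool} -> R) : R := \sum_c weight c * f c.

Definition depends_on S {T : Type} (f : {ffun I -> bool} -> T) :=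
  forall c c', {in S, c =1 c'} -> f c = f c'.

(** Expanding a product of two-term sums, one per vertex, yields one term per coloring. The total
    mass and the law of a single color are special cases. *)
Lemma expect_prod (F : I -> bool -> R) :
  expect (fun c => \prod_i F i (c i)) =
  \prod_i (p * F i true + (1 - p) * F i false).
Proof.
transitivity (\sum_(c : {ffun I -> bool})
  \prod_i (color_weight (c i) * F i (c i))).
  by apply: eq_bigr => c _; rewrite big_split.
rewrite -(bigA_distr_bigA (fun i b => color_weight b * F i b)) /=.
by apply: eq_bigr => i _; rewrite big_bool.
Qed.

Lemma eq_expect f g : f =1 g -> expect f = expect g.
Proof. by move=> fg; apply: eq_bigr => c _; rewrite fg. Qed.

Lemma expect_cst (a : R) : expect (fun=> a) = a.
Proof.
have e1 : expect (fun=> 1) = 1.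
  transitivity (expect (fun c => \prod_(i : I) 1)).
    by apply: eq_expect => c; rewrite big1_eq.
  by rewrite (expect_prod (fun _ _ => 1)) big1 // => i _; ring.
rewrite -[RHS]mul1r -[in RHS]e1 /expect mulr_suml.
by apply: eq_bigr => c _; rewrite mulr1.
Qed.

Lemma expectD f g : expect (fun c => f c + g c) = expect f + expect g.
Proof.
by rewrite /expect -big_split; apply: eq_bigr => c _; rewrite mulrDr.
Qed.

Lemma expectZ a f : expect (fun c => a * f c) = a * expect f.
Proof. by rewrite /expect mulr_sumr; apply: eq_bigr => c _; rewrite mulrCA. Qed.

Lemma expectB f g : expect (fun c => f c - g c) = expect f - expect g.
Proof.
rewrite -mulN1r -expectZ -expectD.
by apply: eq_expect => c; rewrite mulN1r.
Qed.

Lemma expect_sum (J : Type) (r : seq J) (P : pred J) f :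
  expect (fun c => \sum_(j <- r | P j) f j c) =
  \sum_(j <- r | P j) expect (f j).
Proof.
rewrite /expect exchange_big /=.
by apply: eq_bigr => c _; rewrite mulr_sumr.
Qed.

Lemma expect_color i e : expect (fun c => (c i == e)%:R) = color_weight e.
Proof.
transitivity (expect (fun c => \prod_j (if j == i then (c j == e)%:R else 1))).
  apply: eq_expect => c; rewrite (bigD1 i) //= eqxx big1 ?mulr1 // => j.
  by move=> /negbTE ->.
rewrite (expect_prod (fun j b => if j == i then (b == e)%:R else 1)).
rewrite (bigD1 i) //= eqxx big1 ?mulr1; last first.
  by move=> j /negbTE ->; ring.
by case: e; rewrite /color_weight /=; ring.
Qed.

(* Exchanging the coordinates outside [S] between two independent copies is a
   measure-preserving involution of the pairs of colorings. *)
Definition splice S (cc : {ffun I -> bool} * {ffun I -> bool}) :=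
  ([ffun i => if i \in S then cc.1 i else cc.2 i],
   [ffun i => if i \in S then cc.2 i else cc.1 i]).

Lemma spliceK S : involutive (splice S).
Proof.
by case=> c c'; congr pair; apply/ffunP => i; rewrite !ffunE /=;
  case: (i \in S).
Qed.

Lemma weight_splice S cc :
  weight (splice S cc).1 * weight (splice S cc).2 = weight cc.1 * weight cc.2.
Proof.
rewrite /weight -!big_split; apply: eq_bigr => i _ /=.
by rewrite !ffunE; case: ifP => // _; rewrite mulrC.
Qed.

Lemma expect_indep S1 S2 f g : [disjoint S1 & S2] ->
  depends_on S1 f -> depends_on S2 g ->
  expect (fun c => f c * g c) = expect f * expect g.
Proof.
(* Multiplying by the total mass 1 makes the left side a sum over pairs of colorings, like the right
   side; [splice S1] then matches the two sums term by term. *)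
move=> S12 df dg; rewrite -[LHS]mulr1 -(expect_cst 1) /expect !big_distrlr /=.
rewrite !pair_bigA /= [RHS](reindex_inj (inv_inj (spliceK S1))) /=.
apply: eq_bigr => cc _; rewrite !mulr1 mulrACA.
rewrite -[X in _ = X * _]/(weight (splice S1 cc).1 * weight (splice S1 cc).2).
rewrite weight_splice mulrAC; congr (_ * _); congr (_ * _).
  by apply: df => i iS; rewrite ffunE iS.
by apply: dg => i iS; rewrite ffunE (disjointFl S12 iS).
Qed.

Hypotheses (p0 : 0 <= p) (p1 : p <= 1).

Lemma color_weight_ge0 b : 0 <= color_weight b.
Proof. by case: b; rewrite /color_weight //= subr_ge0. Qed.

Lemma le_expect f g : (forall c, f c <= g c) -> expect f <= expect g.
Proof.
move=> fg; apply: ler_sum => c _; apply: ler_wpM2l => //.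
by apply: prodr_ge0 => i _; exact: color_weight_ge0.
Qed.

(** In the expanded square, a product with disjoint windows has mean 0 by independence and
    centering; each remaining product is at most 1. *)
Lemma expect_sqr_sum_le (J : finType) (f : J -> {ffun I -> bool} -> R)
    (W : J -> {set I}) (K : nat) :
  (forall j, depends_on (W j) (f j)) ->
  (forall j, expect (f j) = 0) ->
  (forall j c, `|f j c| <= 1) ->
  (forall j, (#|[set k | ~~ [disjoint W j & W k]]| <= K)%N) ->
  expect (fun c => (\sum_j f j c) ^+ 2) <= (#|J| * K)%:R.
Proof.
move=> df f0 f1 fK.
under eq_expect do rewrite expr2 big_distrlr /=.
rewrite expect_sum mulnC natrM mulr_natr -sumr_const; apply: ler_sum => j _.
rewrite expect_sum.
apply: (@le_trans _ _ (\sum_k (~~ [disjoint W j & W k])%:R)).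
  apply: ler_sum => k _; have [djk|_] := boolP [disjoint _ & _].
    by rewrite (expect_indep (W j) (W k)) // f0 mul0r.
  rewrite -[leRHS](expect_cst 1); apply: le_expect => c.
  apply: le_trans (ler_norm _) _; rewrite normrM -[leRHS]mulr1.
  by apply: ler_pM.
rewrite -natr_sum ler_nat (leq_trans _ (fK j)) // -sum1dep_card.
by rewrite [leqRHS]big_mkcond leq_sum // => k _; case: [disjoint _ & _].
Qed.

End ProductMeasure.

(** * Majority dynamics and alternating balls on the cycle *)

Section Cycle.
Context {m : nat}.
(** With at least 3 vertices, the two neighbours [v + 1] and [v - 1] in the ring of integers mod
    [m.+3] are distinct. *)
Notation V := 'I_m.+3.
Implicit Types (c : {ffun V -> bool}) (v u : V).
Notation adj := (@cycle_adj m.+3).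
Notation step := (@mm_step V adj).

Lemma natr_eq0_cycle k : (k%:R == 0 :> V) = (m.+3 %| k)%N.
Proof. by rewrite -val_eqE /= (@val_Zp_nat m.+3). Qed.

Lemma cycle_succ_neq_pred v : v + 1 != v - 1.
Proof.
rewrite -subr_eq0 (_ : _ - _ = 2%:R); last by ring.
by rewrite natr_eq0_cycle gtnNdvd.
Qed.

Lemma cycle_adjE v u : adj v u = (u == v + 1) || (u == v - 1).
Proof.
have vS (w : V) : ((val w).+1 %% m.+3)%N = val (w + 1) by rewrite /= addn1.
have n1 (w : V) : (w == w + 1) = false.
  by rewrite -subr_eq0 opprD addNKr oppr_eq0 (natr_eq0_cycle 1) gtnNdvd.
rewrite /cycle_adj !vS !val_eqE [u == v - 1]eq_sym subr_eq.
rewrite -[RHS]andTb; case: eqVneq => [->|//].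
by rewrite n1.
Qed.

Lemma card_neighbors (P : pred V) v :
  #|[set u | adj v u && P u]| = (P (v + 1)%R + P (v - 1)%R)%N.
Proof.
rewrite -sum1dep_card big_mkcondr /=.
rewrite (eq_bigl (fun u => u \in [set v + 1; v - 1])); last first.
  by move=> u; rewrite cycle_adjE !inE.
by rewrite big_setU1 ?big_set1 ?inE ?cycle_succ_neq_pred //.
Qed.

Lemma mm_stepE c v :
  step c v = if c (v + 1) == c (v - 1) then c (v + 1) else c v.
Proof.
rewrite ffunE (card_neighbors (fun u => c u)).
rewrite (card_neighbors (fun u => ~~ c u)).
by case: (c (v + 1)); case: (c (v - 1)).
Qed.

(* [c] alternates on the ball of radius [d] around [v], whose endpoints have
   color [e]; [e] is then the color of [v] after [d] rounds. *)
Fixpoint alternating d (e : bool) c v : bool :=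
  if d is d'.+1 then
    [&& alternating d' (~~ e) c v, c (v + d%:R) == e & c (v - d%:R) == e]
  else c v == e.

(** One round shrinks an alternating ball by one layer. Radius 0 must be excluded on the left: a
    single vertex may have color [e] without having just flipped. *)
Lemma alternating_mm_step d e c v :
  alternating d.+1 e (step c) v = alternating d.+2 e c v.
Proof.
elim: d e => [|d IHd] e.
  rewrite /= !mm_stepE.
  have -> : v + 1 + 1 = v + 2%:R by ring.
  have -> : v - 1 - 1 = v - 2%:R by ring.
  rewrite addrK subrK.
  by case: e (c v) (c (v + 1)) (c (v - 1)) (c (v + 2%:R)) (c (v - 2%:R))
    => -[] [] [] [] [].
rewrite [LHS](_ : _ = [&& alternating d.+1 (~~ e) (step c) v,
  step c (v + d.+2%:R) == e & step c (v - d.+2%:R) == e]) // IHd.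
rewrite [RHS](_ : _ = [&& alternating d.+2 (~~ e) c v,
  c (v + d.+3%:R) == e & c (v - d.+3%:R) == e]) //.
(* A vertex at distance [d.+2] has color [~~ e] and an inner neighbour of color [e], so it flips
   exactly when its outer neighbour has color [e] too. *)
case a : (alternating d.+2 _ _ _) => //=.
move: a => /= /and3P[/and3P[_ /eqP c1 /eqP c2] /eqP c3 /eqP c4].
rewrite !mm_stepE.
have -> : v + d.+2%:R + 1 = v + d.+3%:R by ring.
have -> : v - d.+2%:R - 1 = v - d.+3%:R by ring.
have -> : v + d.+2%:R - 1 = v + d.+1%:R by ring.
have -> : v - d.+2%:R + 1 = v - d.+1%:R by ring.
rewrite c1 c2 c3 c4.
by case: (e) (c (v + d.+3%:R)) (c (v - d.+3%:R)) => -[] [].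
Qed.

Lemma alternating_mm_iter t d e c v :
  alternating d.+1 e (mm_iter adj t c) v = alternating (d + t).+1 e c v.
Proof.
elim: t d => [|t IHt] d; first by rewrite addn0.
by rewrite /mm_iter iterS alternating_mm_step IHt addSnnS.
Qed.

Lemma mm_step_alternating (R : realType) c v : (step c v)%:R =
  (c v)%:R + (alternating 1 true c v)%:R - (alternating 1 false c v)%:R :> R.
Proof.
rewrite mm_stepE /=.
by case: (c v) (c (v + 1)) (c (v - 1)) => -[] [] /=; ring.
Qed.

Lemma mm_iter_alternating (R : realType) t c v :
  (mm_iter adj t c v)%:R = (c v)%:R + \sum_(1 <= d < t.+1)
    ((alternating d true c v)%:R - (alternating d false c v)%:R) :> R.
Proof.
elim: t => [|t IHt]; first by rewrite big_geq // addr0.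
rewrite big_nat_recr //= addrA -IHt.
by rewrite mm_step_alternating !(alternating_mm_iter t 0) /= addrA.
Qed.

Lemma stable_alternating t c :
  (forall v e, ~~ alternating t.+1 e c v) -> stable adj (mm_iter adj t c).
Proof.
move=> alt; apply/eqP/ffunP => v; rewrite mm_stepE.
have:= alt v true; have:= alt v false; rewrite -!(alternating_mm_iter t 0) /=.
set c' := mm_iter _ _ _.
by case: (c' v) (c' (v + 1)) (c' (v - 1)) => -[] [].
Qed.

(** * Balls on the cycle: size, intersection, and vertices outside *)

Definition window d v : {set V} :=
  [set v + (k : nat)%:R | k : 'I_d.+1] :|: [set v - (k : nat)%:R | k : 'I_d.+1].

Lemma windowP d v u : reflect
  (exists2 k, (k <= d)%N & u = v + k%:R \/ u = v - k%:R) (u \in window d v).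
Proof.
apply: (iffP setUP) => [[]/imsetP[k _ ->]|[k kd [->|->]]].
- by exists k; [rewrite -ltnS|left].
- by exists k; [rewrite -ltnS|right].
- by left; apply/imsetP; exists (Ordinal (kd : (k < d.+1)%N)).
- by right; apply/imsetP; exists (Ordinal (kd : (k < d.+1)%N)).
Qed.

Lemma window_incl d d' v : (d <= d')%N -> window d v \subset window d' v.
Proof.
move=> dd'; apply/subsetP => u /windowP[k kd uE]; apply/windowP.
by exists k => //; exact: leq_trans dd'.
Qed.

Lemma card_window d v : (#|window d v| <= d.+1.*2)%N.
Proof.
rewrite -addnn (leq_trans (leq_card_setU _ _)) // leq_add //;
  by rewrite (leq_trans (leq_imset_card _ _)) // card_ord.
Qed.

(** Triangle inequality, by cases on the signs of the two offsets. With [card_window] it bounds the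
    number of windows meeting a given one. *)
Lemma window_meet d v u : ~~ [disjoint window d v & window d u] ->
  u \in window (d + d) v.
Proof.
case/pred0Pn => x /andP[/= /windowP[k kd xv] /windowP[l ld xu]]; apply/windowP.
have leB a b : (a <= d)%N -> (a - b <= d + d)%N by lia.
have [xv'|xv'] := xv; have [xu'|xu'] := xu.
- have uE : u = v + k%:R - l%:R by rewrite -xv' xu' addrK.
  case: (leqP l k) => lk.
    by exists (k - l)%N; [exact: leB|left; rewrite uE natrB // addrA].
  exists (l - k)%N; [exact: leB|right; rewrite uE natrB ?(ltnW lk) //; ring].
- exists (k + l)%N; [exact: leq_add|left].
  by rewrite natrD addrA -xv' xu' subrK.
- exists (k + l)%N; [exact: leq_add|right].
  by rewrite natrD opprD addrA -xv' xu' addrK.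
- have uE : u = v - k%:R + l%:R by rewrite -xv' xu' subrK.
  case: (leqP k l) => lk.
    exists (l - k)%N; [exact: leB|left; rewrite uE natrB //; ring].
  by exists (k - l)%N; [exact: leB|right; rewrite uE natrB ?(ltnW lk) //; ring].
Qed.

(** Membership would make [m.+3] divide [k - l] or [k + l] for some [l <= d], but both lie strictly
    between 0 and [m.+3]. *)
Lemma notin_window d k v : (d < k)%N -> (d + k < m.+3)%N ->
  (v + k%:R \notin window d v) && (v - k%:R \notin window d v).
Proof.
move=> dk kn; have nz j : (0 < j < m.+3)%N -> (j%:R == 0 :> V) = false.
  by case/andP => j0 jn; rewrite natr_eq0_cycle gtnNdvd.
apply/andP; split; apply/negP => /windowP[l ld [/addrI|/addrI]] /eqP.
- by rewrite -subr_eq0 -natrB ?nz; lia.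
- by rewrite -subr_eq0 opprK -natrD nz; lia.
- by rewrite eq_sym -subr_eq0 opprK -natrD nz; lia.
- by rewrite eqr_opp -subr_eq0 -natrB ?nz; lia.
Qed.

Lemma alternating_depends d e v :
  depends_on (window d v) (alternating d e ^~ v).
Proof.
elim: d e => [|d IHd] e c c' cc' /=.
  by rewrite cc' //; apply/windowP; exists 0; rewrite // addr0; left.
rewrite !cc' ?(IHd _ c c') //.
- by move=> u ud; apply: cc'; exact: (subsetP (window_incl _ _ _ (leqnSn d))).
- by apply/windowP; exists d.+1; rewrite //; right.
- by apply/windowP; exists d.+1; rewrite //; left.
Qed.

(** * Mean, variance and concentration of the number of blue vertices *)

Section Probability.
Context {R : realType} (p : R).

(** Each new layer adds two independent vertices of color [e] around a ball ending in [~~ e], and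
    the weight of [~~ e] times that of [e] is [p * (1 - p)]. *)
Lemma expect_alternating d v : (d + d < m.+3)%N -> forall e,
  expect p (fun c => (alternating d e c v)%:R) =
  color_weight p e * (p * (1 - p)) ^+ d.
Proof.
elim: d => [|d IHd] dn e; first by rewrite /= expect_color expr0 mulr1.
have [] := andP (notin_window d d.+1 v (ltnSn d) _); first by lia.
move=> vp vm.
pose g u c : R := (c u == e)%:R.
have dg u : depends_on [set u] (g u).
  by move=> c c' cc'; rewrite /g cc' ?inE.
have neq : v + d.+1%:R != v - d.+1%:R.
  rewrite -subr_eq0 (_ : _ - _ = (d.+1 + d.+1)%:R); last by rewrite natrD; ring.
  by rewrite natr_eq0_cycle gtnNdvd.
transitivity (expect p (fun c => (alternating d (~~ e) c v)%:R *
  (g (v + d.+1%:R) c * g (v - d.+1%:R) c))).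
  apply: eq_expect => c; rewrite /g [alternating _ _ _ _]/=.
  by rewrite -!natrM !mulnb.
rewrite (expect_indep p (window d v) [set v + d.+1%:R; v - d.+1%:R]);
  first last.
- move=> c c' cc'; congr (_ * _); apply: dg => u /set1P ->;
    by apply: cc'; rewrite !inE eqxx ?orbT.
- by move=> c c' /alternating_depends ->.
- rewrite disjoint_sym; apply/pred0P => u /=.
  by apply/negP => /andP[/set2P[->|->]]; exact: negP.
rewrite (expect_indep p [set v + d.+1%:R] [set v - d.+1%:R]) //; last first.
  by rewrite disjoints1 inE.
rewrite !expect_color IHd; last by lia.
by case: (e) => /=; rewrite /color_weight exprS; ring.
Qed.

(* The probability that a vertex is blue after [t] rounds, as long as its
   window does not wrap around the cycle. *)
Definition blue_prob t : R :=
  p + (2 * p - 1) * \sum_(1 <= d < t.+1) (p * (1 - p)) ^+ d.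

Lemma expect_mm_iter t v : (t + t < m.+3)%N ->
  expect p (fun c => (mm_iter adj t c v)%:R) = blue_prob t.
Proof.
move=> tn; under eq_expect do rewrite mm_iter_alternating.
rewrite expectD expect_sum; congr (_ + _).
  rewrite -[RHS]/(color_weight p true) -(expect_color p v true).
  by apply: eq_expect => c; rewrite eqb_id.
rewrite mulr_sumr !big_nat; apply: eq_bigr => d /andP[_ dt].
by rewrite expectB !expect_alternating /color_weight; [ring|lia|lia].
Qed.

Hypotheses (p0 : 0 <= p) (p1 : p <= 1).

(** Read off from the probabilistic meaning of [blue_prob]; it keeps the centered indicators in the
    variance bound within [-1, 1]. *)
Lemma blue_prob_itv t : (t + t < m.+3)%N -> 0 <= blue_prob t <= 1.
Proof.
move=> tn; rewrite -(expect_mm_iter t 0 tn).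
have e0 := expect_cst (I := V) p 0; have e1 := expect_cst (I := V) p 1.
apply/andP; split; [rewrite -[leLHS]e0|rewrite -[leRHS]e1];
  apply: le_expect => // c.
by rewrite lern1 leq_b1.
Qed.

Lemma nblueE c : (nblue c)%:R = \sum_v (c v)%:R :> R.
Proof.
rewrite /nblue -sum1dep_card natr_sum big_mkcond /=.
by apply: eq_bigr => v _; case: (c v).
Qed.

Lemma mm_iter_depends t v :
  depends_on (window t v) (fun c => (mm_iter adj t c v)%:R : R).
Proof.
move=> c c' cc'; rewrite !mm_iter_alternating.
have agree d : (d <= t)%N -> {in window d v, c =1 c'}.
  by move=> dt u ud; apply: cc'; exact: (subsetP (window_incl _ _ _ dt)).
congr (_ + _).
  have := alternating_depends 0 true v _ _ (agree 0 (leq0n t)).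
  by rewrite /= !eqb_id => ->.
rewrite !big_nat; apply: eq_bigr => d /andP[_ dt].
by rewrite !(alternating_depends d _ v _ _ (agree d dt)).
Qed.

Lemma expect_nblue_variance t : (t + t < m.+3)%N ->
  expect p (fun c =>
    ((nblue (mm_iter adj t c))%:R - m.+3%:R * blue_prob t) ^+ 2)
  <= (m.+3 * (t + t).+1.*2)%:R.
Proof.
move=> tn; have /andP[b0 b1] := blue_prob_itv t tn.
pose f v c : R := (mm_iter adj t c v)%:R - blue_prob t.
rewrite (eq_expect _ _ (fun c => (\sum_v f v c) ^+ 2)); last first.
  by move=> c; rewrite nblueE sumrB sumr_const card_ord mulr_natl.
rewrite -[X in (X * _)%N](card_ord m.+3).
apply: (expect_sqr_sum_le _ p0 p1 _ _ (window t)) => [v|v|v c|v].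
- by move=> c c' cc'; rewrite /f (mm_iter_depends t v _ _ cc').
- by rewrite expectB expect_cst expect_mm_iter // subrr.
- by rewrite /f ler_norml; case: (mm_iter _ _ _ _) => /=; lra.
- rewrite (leq_trans _ (card_window (t + t) v)) // subset_leq_card //.
  by apply/subsetP => u; rewrite inE => /window_meet.
Qed.

Lemma prandE (A : pred {ffun V -> bool}) :
  prand p A = expect p (fun c => (A c)%:R).
Proof.
rewrite /prand /expect big_mkcond; apply: eq_bigr => c _.
by case: (A c); rewrite ?mulr1 ?mulr0.
Qed.

Lemma prand_stable_concentrated t (eta : R) (A : pred {ffun V -> bool}) :
  (t.+1 + t.+1 < m.+3)%N -> 0 < eta ->
  (forall c, stable adj (mm_iter adj t c) ->
    `|(nblue (mm_iter adj t c))%:R - m.+3%:R * blue_prob t| <= eta * m.+3%:R ->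
    A c) ->
  1 - (m.+3%:R * (p * (1 - p)) ^+ t.+1 +
       (t + t).+1.*2%:R / (eta ^+ 2 * m.+3%:R)) <= prand p A.
Proof.
move=> tn eta0 hA; rewrite prandE lerBlDr.
have n0 : 0 < m.+3%:R :> R by rewrite ltr0n.
pose dev c : R := (nblue (mm_iter adj t c))%:R - m.+3%:R * blue_prob t.
pose bad c : R := \sum_v
  ((alternating t.+1 true c v)%:R + (alternating t.+1 false c v)%:R).
pose K := (eta * m.+3%:R) ^+ 2.
have K0 : 0 < K by rewrite exprn_gt0 // mulr_gt0.
have bad0 c : 0 <= bad c by apply: sumr_ge0 => v _; rewrite addr_ge0 ?ler0n.
(* Union bound and Chebyshev in one pointwise inequality: outside [A], either an alternating ball
   makes [bad c] at least 1, or the deviation makes the last term at least 1. *)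
apply: (@le_trans _ _ (expect p (fun c =>
  (A c)%:R + (bad c + K^-1 * dev c ^+ 2)))).
  rewrite -[leLHS](expect_cst (I := V) p 1); apply: le_expect => // c.
  have dev0 : 0 <= K^-1 * dev c ^+ 2.
    by rewrite mulr_ge0 ?sqr_ge0 // invr_ge0 ltW.
  have [Ac|nAc] := boolP (A c); first by rewrite lerDl addr_ge0.
  rewrite mulr0n add0r; have [st|nst] := boolP (stable adj (mm_iter adj t c)).
    have [dl|dl] := lerP `|dev c| (eta * m.+3%:R); first by rewrite hA in nAc.
    rewrite -[leLHS]add0r lerD // mulrC ler_pdivlMr // mul1r.
    rewrite -[leRHS]real_normK ?num_real //.
    by rewrite ler_sqr ?nnegrE ?normr_ge0 ?(ltW dl) // mulr_ge0 // ltW.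
  have [v [e alt]] : exists v e, alternating t.+1 e c v.
    apply/not_existsP => H; move/negP: nst; apply.
    apply: stable_alternating => v e.
    by apply/negP => alt; apply: (H v); exists e.
  rewrite -[leLHS]addr0 lerD //.
  have rest : 0 <= \sum_(u | u != v)
      ((alternating t.+1 true c u)%:R + (alternating t.+1 false c u)%:R) :> R.
    by apply: sumr_ge0 => u _; rewrite addr_ge0 ?ler0n.
  rewrite /bad (bigD1 v) // -[leLHS]addr0 lerD //.
  by case: e alt => ->; rewrite ?lerDl ?lerDr ler0n.
rewrite !expectD expectZ lerD // lerD //.
  rewrite expect_sum mulr_natl -[X in _ *+ X](card_ord m.+3) -sumr_const.
  apply: ler_sum => v _; rewrite expectD !expect_alternating // /color_weight; lra.
rewrite mulrC ler_pdivrMr //; apply: le_trans (expect_nblue_variance t _) _.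
  by lia.
rewrite natrM /K le_eqVlt; apply/orP; left; apply/eqP; field.
by rewrite (gt_eqF eta0) andbT -natrD pnatr_eq0.
Qed.

End Probability.
End Cycle.

(** * Limiting density and asymptotics in the cycle length *)

Lemma mul_subr1_le_quarter (R : realType) (p : R) : p * (1 - p) <= 1 / 4.
Proof. by have := sqr_ge0 (p - 1 / 2); nra. Qed.

(** The difference is the tail of a geometric series of ratio [x = p * (1 - p) <= 1 / 4]; it is
    nonnegative because [2 * p - 1] is. *)
Lemma blue_prob_limit (R : realType) (p : R) t : 1 / 2 <= p -> p <= 1 ->
  0 <= (2 * p ^+ 2 - p ^+ 3) / (1 - p + p ^+ 2) - blue_prob p t <= (1 / 4) ^+ t.
Proof.
move=> hp hp1; set x := p * (1 - p).
have x0 : 0 <= x by rewrite mulr_ge0 //; lra.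
have x4 : x <= 1 / 4 by exact: mul_subr1_le_quarter.
have dE : 1 - p + p ^+ 2 = 1 - x by rewrite /x; ring.
have d0 : 1 - x != 0 by rewrite gt_eqF //; lra.
have -> : (2 * p ^+ 2 - p ^+ 3) / (1 - p + p ^+ 2) - blue_prob p t =
    (2 * p - 1) * (x / (1 - x)) * x ^+ t.
  rewrite dE /blue_prob -/x; elim: t => [|t IHt].
    by rewrite big_geq // expr0; move: d0; rewrite /x => d0; field.
  rewrite big_nat_recr //= mulrDr addrA opprD addrA IHt.
  by rewrite exprSr; field.
have q0 : 0 <= x / (1 - x) by rewrite divr_ge0 //; lra.
have q1 : x / (1 - x) <= 1 by rewrite ler_pdivrMr; lra.
have xt : x ^+ t <= (1 / 4) ^+ t by rewrite lerXn2r ?nnegrE //; lra.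
apply/andP; split; first by rewrite mulr_ge0 ?exprn_ge0 // mulr_ge0 //; lra.
apply: le_trans xt; rewrite -[leRHS]mul1r ler_wpM2r ?exprn_ge0 //.
by rewrite mulr_ile1 //; lra.
Qed.

Lemma trunc_log_small (M : nat) : exists N : nat, forall n : nat, (N <= n)%N ->
  (M * (trunc_log 2 n).+1 <= n)%N.
Proof.
have sq k : (k.+1 ^ 2 <= 4 * 2 ^ k)%N.
  elim: k => [//|[//|[//|k]]]; rewrite [(2 ^ k.+3)%N]expnS -!mulnn.
  by move: (2 ^ k.+2)%N => y; nia.
exists (4 * M ^ 2).+1 => n Mn; have n0 : (0 < n)%N by lia.
have := trunc_logP (isT : (1 < 2)%N) n0; have := sq (trunc_log 2 n).
move: (trunc_log 2 n).+1 (2 ^ _)%N => T y; rewrite -mulnn => T2 yn.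
(* If [4 * M <= T], then [4 * M * T <= T * T <= 4 * n]; otherwise [M * T <= 4 * M ^ 2 < n]. *)
rewrite -mulnn in Mn; case: (leqP (4 * M) T) => MT; nia.
Qed.

Theorem theorem4p1 (R : realType) (p : R) (hp : 1 / 2 <= p) (hp1 : p <= 1)
  (eps : R) (heps : 0 < eps) :
  let rho := (2 * p ^+ 2 - p ^+ 3) / (1 - p + p ^+ 2) in
  exists C : R, 0 < C /\
    forall delta : R, 0 < delta ->
    exists N : nat, forall n : nat, (N <= n)%N ->
      1 - delta <=
      @prand R n p (fun c : {ffun 'I_n -> bool} =>
        `[< exists t : nat,
              t%:R <= C * ln (n%:R : R) /\
              stable (@cycle_adj n) (mm_iter (@cycle_adj n) t c) /\
              (1 - eps) * rho * n%:R <= (nblue (mm_iter (@cycle_adj n) t c))%:R /\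
              (nblue (mm_iter (@cycle_adj n) t c))%:R <= (1 + eps) * rho * n%:R >]).
Proof.
move=> rho.
have ln2 : 0 < ln (2 : R) by rewrite ln_gt0 // ltr1n.
(* The number of rounds will be [trunc_log 2 n], at most [ln n / ln 2]. *)
exists (ln 2)^-1; split; first by rewrite invr_gt0.
(* Since [rho >= 1 / 2], the allowed error is at least [eps / 2] per vertex: half for the random
   deviation, half for the bias of [blue_prob]. *)
move=> delta delta0; pose eta := eps / 4.
have eta0 : 0 < eta by rewrite divr_gt0.
have eta2 : 0 < eta ^+ 2 by rewrite exprn_gt0.
(* The four terms serve, in order, the non-wrapping of balls of radius [t.+1], the union bound, the
   bias and Chebyshev, all through [M * t.+1 <= n]. *)
pose B := 3 + 2 / delta + 16 / eps + 8 / (eta ^+ 2 * delta).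
have [M BM] : exists M : nat, B <= M%:R.
  exists (Num.truncn B).+1; exact/ltW/truncnS_gt.
have t1 : 0 < 2 / delta by rewrite divr_gt0.
have t2 : 0 < 16 / eps by rewrite divr_gt0.
have t3 : 0 < 8 / (eta ^+ 2 * delta) by rewrite divr_gt0 // mulr_gt0.
have M3 : (3 <= M)%N by rewrite -(ler_nat R); move: BM; rewrite /B; lra.
have M0 : 0 < M%:R :> R by rewrite ltr0n (leq_trans _ M3).
have Md : 2 <= delta * M%:R.
  by rewrite mulrC -ler_pdivrMr //; move: BM; rewrite /B; lra.
have Me : 16 <= eps * M%:R.
  by rewrite mulrC -ler_pdivrMr //; move: BM; rewrite /B; lra.
have Mx : 8 <= eta ^+ 2 * delta * M%:R.
  by rewrite mulrC -ler_pdivrMr ?mulr_gt0 //; move: BM; rewrite /B; lra.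
have [N hN] := trunc_log_small M; exists (maxn N 3) => n.
rewrite geq_max => /andP[/hN]; case: n => [|[|[|m]]] //.
set n := m.+3; set t := trunc_log 2 n => Mn _.
have n0 : 0 < n%:R :> R by rewrite ltr0n.
have tn : (2 ^ t <= n)%N by exact: trunc_logP.
have nt : (n < 2 ^ t.+1)%N by exact: trunc_log_ltn.
have MnR : M%:R * t.+1%:R <= n%:R :> R by rewrite -natrM ler_nat.
have MnR' : M%:R <= n%:R :> R by rewrite ler_nat (leq_trans _ Mn) // leq_pmulr.
pose h : R := (1 / 4) ^+ t.+1.
have h0 : 0 < h by rewrite exprn_gt0 //; lra.
(* Here [n ^ 2 <= 4 ^ t.+1], so [n * h], which dominates the union bound, is at most [1 / n]. *)
have hn : n%:R * (n%:R * h) <= 1.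
  rewrite mulrA /h expr_div_n expr1n mul1r ler_pdivrMr ?exprn_gt0 // mul1r.
  rewrite -natrX -natrM ler_nat.
  have -> : (4 ^ t.+1 = 2 ^ t.+1 * 2 ^ t.+1)%N by rewrite -expnMn.
  by rewrite leq_mul // ltnW.
have nh : n%:R * h <= delta / 2.
  have : n%:R * h * M%:R <= 1.
    by apply: le_trans hn; rewrite mulrC ler_wpM2r // mulr_ge0 // ltW.
  move=> hM; rewrite -(ler_pM2r M0).
  by apply: le_trans hM _; lra.
have /andP[r0 r1] := blue_prob_limit R p t hp hp1; rewrite -/rho in r0 r1.
have r2 : (1 / 4) ^+ t <= eps / 4.
  have -> : (1 / 4) ^+ t = 4 * h :> R by rewrite /h exprS; lra.
  have n1 : 1 <= n%:R :> R by rewrite ler1n.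
  have : n%:R * h <= 1 by nra.
  nra.
(* At time 0 the blue probability is [p], which is therefore at most [rho]. *)
have rho2 : 1 / 2 <= rho.
  have /andP[+ _] := blue_prob_limit R p 0 hp hp1.
  by rewrite -/rho /blue_prob big_geq //; lra.
apply: le_trans (prand_stable_concentrated p _ hp1 t eta _ _ eta0 _); first last.
- move=> c st dv; apply/asboolP; exists t; split.
    rewrite mulrC ler_pdivlMr // mulr_natl -lnXn // ler_ln ?posrE ?exprn_gt0 //.
    by rewrite -natrX ler_nat.
  split=> //; move: dv; rewrite -/n ler_norml /eta => /andP[].
  set X := (nblue _)%:R; set b := blue_prob _ _ in r0 r1 *.
  move=> d1 d2; have : 0 <= eps * (rho - 1 / 2) * n%:R.
    by rewrite !mulr_ge0 ?(ltW n0) ?(ltW heps) //; lra.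
  have : 0 <= n%:R * (rho - b) by rewrite mulr_ge0 // ltW.
  have : n%:R * (rho - b) <= n%:R * (eps / 4).
    by rewrite ler_wpM2l ?(ltW n0) //; lra.
  by move=> *; split; nra.
- rewrite -/n; apply: leq_trans Mn; 
  apply: leq_trans (leq_mul M3 (leqnn _)).
  by move: (t) => k; clear; lia.
- lra.
rewrite lerD2l lerN2 [leRHS](_ : delta = delta / 2 + delta / 2); last by field.
rewrite lerD //.
  apply: le_trans nh; rewrite ler_wpM2l ?(ltW n0) // /h lerXn2r //.
  - by rewrite nnegrE mulr_ge0 //; lra.
  - by rewrite nnegrE; lra.
  - exact: mul_subr1_le_quarter.
rewrite ler_pdivrMr ?(mulr_gt0 eta2 n0) //.
apply: (@le_trans _ _ (4 * t.+1%:R)).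
  by rewrite -natrM ler_nat; move: (t) => k; clear; lia.
have : 8 * t.+1%:R <= eta ^+ 2 * delta * M%:R * t.+1%:R by rewrite ler_wpM2r.
have : eta ^+ 2 * delta * (M%:R * t.+1%:R) <= eta ^+ 2 * delta * n%:R.
  by rewrite ler_wpM2l // mulr_ge0 // ltW.
by rewrite -/n; lra.
Qed.
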